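(* Let $\lambda>0$ be a real number and let $T:\mathbb{R}[x]\to\mathbb{R}[x]$ be the differential operator $T(p)(x)=\lambda p(x)+x\,p'(x)$. Then for every nonzero polynomial $p\in\mathbb{R}[x]$ all of whose roots are real and of the same sign (all strictly positive or all strictly negative), one has $$\mathrm{lmesh}(T(p))\ \ge\ \mathrm{lmesh}(p).$$ (In particular, the roots of $T(p)$ are all real and of the same sign, so that $\mathrm{lmesh}(T(p))$ is defined.)
   Context: Let $P$ be a real polynomial of degree $k$ all of whose roots are real and of the same sign (all strictly positive or all strictly negative). List its roots with multiplicity, ordered so that $|x_1|\le |x_2|\le\dots\le |x_k|$. The logarithmic mesh of $P$ is $$\mathrm{lmesh}(P)=\min_{j=1,\dots,k-1}\frac{|x_{j+1}|}{|x_j|}.$$ When $k\le 1$ the minimum is over the empty set and is understood to be $+\infty$. *)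

(* Defs.v *)
From mathcomp Require Import all_boot all_order all_algebra.
From mathcomp Require Import reals constructive_ereal.
From mathcomp Require Import complex polyrcf.

Set Implicit Arguments.
Unset Strict Implicit.
Unset Printing Implicit Defensive.

Import Order.TTheory GRing.Theory Num.Theory.

Local Open Scope ring_scope.
Local Open Scope complex_scope.

(* "All roots" means all complex roots.  The property fails for [p = 0] and
   holds vacuously for nonzero constants. *)
Definition all_roots_pos (R : realType) (p : {poly R}) : Prop :=
  forall z : R[i], root (map_poly (real_complex R) p) z ->
    complex.Im z = 0 /\ 0 < complex.Re z.

Definition all_roots_neg (R : realType) (p : {poly R}) : Prop :=
  forall z : R[i], root (map_poly (real_complex R) p) z ->
    complex.Im z = 0 /\ complex.Re z < 0.

Definition real_roots_same_sign (R : realType) (p : {poly R}) : Prop :=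
  all_roots_pos p \/ all_roots_neg p.

(* [rootsR p] lists the distinct real roots of [p] (it is empty for [p = 0]);
   each root is repeated according to its multiplicity [mup x p]. *)
Definition roots_by_modulus (R : realType) (p : {poly R}) : seq R :=
  sort (fun x y => `|x| <= `|y|)
       (flatten [seq nseq (mup x p) x | x <- rootsR p]).

(* Equal to [+oo] when there is at most one root.  Only meaningful for
   polynomials satisfying [real_roots_same_sign]. *)
Definition lmesh (R : realType) (p : {poly R}) : \bar R :=
  let s := roots_by_modulus p in
  \big[Order.min/+oo%E]_(j < (size s).-1) (`|s`_j.+1| / `|s`_j|)%:E.

Definition diff_op (R : realType) (lambda : R) (p : {poly R}) : {poly R} :=
  lambda *: p + 'X * p^`().

(* Main.v *)
Require Import Defs.
From mathcomp Require Import all_boot all_order all_algebra.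
From mathcomp Require Import separable.
From mathcomp Require Import reals constructive_ereal.
From mathcomp Require Import complex polyrcf.
From mathcomp Require Import ring lra zify.

(** Write p as c times the product of the [X - x_i].  Away from the roots of p,
    a point z is a root of T(p) = lambda p + X p' exactly when

      S(z) := \sum_i z / (z - x_i) = - lambda,

    and everything is read off this equation.

    Reality and sign: the imaginary part of z / (z - x_i) is [- x_i Im z] over
    [|z - x_i|^2]; as the x_i have a common sign, these terms cannot cancel
    unless z is real ([euler_sum_root_real]).  A real z that is zero or of the
    opposite sign would make every term of S(z) nonnegative.

    Mesh: each term depends only on the ratio x_i / z, through
    g(v) = 1 / (1 - v), which increases on v < 1 and on v > 1.  Suppose that
    two consecutive roots y, y' of T(p) have |y'| = r |y| with r smaller than
    every ratio |x_{i+1}| / |x_i|.  Replacing all roots by their moduli, compare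
    S(y) with S(y') = S(r y).  If no |x_i| lies between |y| and r |y|, no term
    crosses its pole and S strictly decreases from |y| to r |y|; there is at
    least one term, as the empty sum is not [- lambda].  If some |x_i| does,
    compare the term of index i in S(|y|) with that of index i+1 in S(r |y|):
    the gap condition r |x_i| < |x_{i+1}| makes the ratio grow and puts both
    terms on the same side of the pole, while the two unmatched terms have
    opposite signs, so that S strictly increases.  Either way S(y) <> S(y')
    ([euler_sum_dilation_neq]), a contradiction.

    Since the roots are listed by modulus, r >= 1 always; so r below the mesh
    of p forces p to have simple roots.  The comparison needs r > 1, that is,
    T(p) must have simple roots as well, which follows from Laguerre's
    inequality p p'' <= p'^2 ([deriv_diff_op_neq0]). *)

Set Implicit Arguments.
Unset Strict Implicit.
Unset Printing Implicit Defensive.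

Import Order.TTheory GRing.Theory Num.Theory.

Local Open Scope ring_scope.

(** * Logarithmic derivatives and roots of [lambda p + X p'] *)

Lemma horner_deriv_prod_XsubC (F : fieldType) (s : seq F) (z : F) :
  z \notin s ->
  (\prod_(x <- s) ('X - x%:P))^`().[z] =
    (\prod_(x <- s) ('X - x%:P)).[z] * \sum_(x <- s) (z - x)^-1.
Proof.
elim: s => [|a s IHs]; first by rewrite !big_nil derivC hornerC mulr0.
rewrite inE negb_or => /andP[za zs]; rewrite !big_cons derivM derivXsubC mul1r.
rewrite hornerD !hornerM hornerXsubC IHs // mulrDr mulrAC divff ?subr_eq0 //.
by rewrite mul1r mulrA.
Qed.

Lemma root_euler_op_sum (F : fieldType) (lambda c : F) (s : seq F) (z : F)
    (p := c *: \prod_(x <- s) ('X - x%:P)) :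
  c != 0 -> z \notin s -> root (lambda *: p + 'X * p^`()) z ->
  \sum_(x <- s) z / (z - x) = - lambda.
Proof.
move=> c0 zs; rewrite /root hornerD hornerM hornerX hornerZ derivZ !hornerZ.
rewrite horner_deriv_prod_XsubC // => /eqP h.
have q0 : (\prod_(x <- s) ('X - x%:P)).[z] != 0.
  by rewrite -[_ == 0]/(root _ z) root_prod_XsubC.
rewrite -mulr_sumr; apply: (mulfI c0); apply: (mulfI q0).
by apply/eqP; rewrite -subr_eq0 -[X in _ == X]h; apply/eqP; ring.
Qed.

(** The imaginary part of the sum is [Im z] times a sum of terms of one sign,
    and there is at least one term, as the empty sum is not [- lambda]; this
    forces [Im z = 0].  The real part would then be a sum of nonnegative terms
    if z were not on the half-line of the x. *)
Lemma euler_sum_root_real (R : rcfType) (lambda e : R) (s : seq R) (z : R[i]) :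
  0 < lambda -> e != 0 -> {in s, forall x, 0 < e * x} ->
  \sum_(x <- s) z / (z - real_complex R x) = - real_complex R lambda ->
  complex.Im z = 0 /\ 0 < e * complex.Re z.
Proof.
move=> lambda_gt0 e0 s_gt0; case: z => a b /=.
pose N x : R := (a - x) ^+ 2 + b ^+ 2.
pose u x := (a * (a - x) + b ^+ 2) / N x; pose v x := - (x * b) / N x.
have termE x : Complex a b / (Complex a b - real_complex R x)
    = Complex (u x) (v x).
  rewrite -[Complex a b / _]/(Complex _ _) /u /v /N /=.
  by rewrite !oppr0 !addr0; congr Complex; ring.
have sumE : \sum_(x <- s) Complex a b / (Complex a b - real_complex R x)
    = Complex (\sum_(x <- s) u x) (\sum_(x <- s) v x).
  elim: s {s_gt0} => [|x s IHs]; first by rewrite !big_nil.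
  by rewrite !big_cons IHs termE.
rewrite sumE => -[sumu]; rewrite oppr0 => sumv.
have N_ge0 x : 0 <= N x by rewrite addr_ge0 ?sqr_ge0.
have b0 : b = 0.
  apply/eqP; apply: contraT => b_neq0.
  have N_gt0 x : 0 < N x by rewrite ltr_wpDl ?sqr_ge0 // exprn_even_gt0.
  have h0 : \sum_(x <- s) e * x / N x = 0.
    have -> : \sum_(x <- s) e * x / N x = - (e / b) * \sum_(x <- s) v x.
      rewrite mulr_sumr; apply: eq_bigr => x _; rewrite /v.
      by field; rewrite b_neq0 gt_eqF.
    by rewrite sumv mulr0.
  case: s s_gt0 sumu h0 {sumE sumv} => [_|x s s_gt0 _].
    by rewrite big_nil => h; lra.
  rewrite big_cons => h.
  have : 0 < e * x / N x by rewrite divr_gt0 ?s_gt0 ?mem_head.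
  have : 0 <= \sum_(y <- s) e * y / N y.
    rewrite big_seq sumr_ge0 // => y ys.
    by rewrite divr_ge0 // ltW // s_gt0 // inE ys orbT.
  lra.
split=> //; rewrite ltNge; apply/negP => ea_le0.
suff : 0 <= \sum_(x <- s) u x by lra.
rewrite big_seq sumr_ge0 // => x xs; rewrite divr_ge0 // b0 expr0n addr0.
have e2 : 0 < e ^+ 2 by rewrite exprn_even_gt0.
rewrite -(pmulr_rge0 _ e2); have := s_gt0 x xs; nra.
Qed.

(** Laguerre's inequality.  Multiplying by [X - a] turns the defect
    [q'^2 - q q''] into [q^2 + (X - a)^2 (q'^2 - q q'')]. *)
Lemma laguerre_prod_XsubC (R : realDomainType) (s : seq R) (z : R)
    (q := \prod_(x <- s) ('X - x%:P)) :
  q.[z] * q^`()^`().[z] <= q^`().[z] ^+ 2.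
Proof.
rewrite {}/q; elim: s => [|a s]; first by rewrite big_nil !derivC !hornerC; nra.
rewrite !big_cons; set q := \prod_(x <- s) _ => IHs.
have -> : (('X - a%:P) * q)^`() = q + ('X - a%:P) * q^`().
  by rewrite derivM derivXsubC mul1r.
rewrite derivD derivM derivXsubC mul1r.
rewrite !(hornerD, hornerM, hornerN, hornerX, hornerC).
have := mulr_ge0 (sqr_ge0 (z - a)) (etrans (subr_ge0 _ _) IHs).
have := sqr_ge0 q.[z].
set A := q.[z]; set B := q^`().[z]; set C := q^`()^`().[z]; nra.
Qed.

(** Monotonicity of [g v = 1 / (1 - v)] on each side of its pole, at [v = x / b]
    and [v = x' / b']; the positive product says that the two ratios are on the
    same side of 1. *)
Lemma euler_term_lt (R : realFieldType) (b x b' x' : R) :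
  0 < (b - x) * (b' - x') -> x * b' < x' * b ->
  b / (b - x) < b' / (b' - x').
Proof.
move=> h lt; rewrite -subr_gt0.
have : (b - x) * (b' - x') != 0 by rewrite gt_eqF.
rewrite mulf_eq0 negb_or => /andP[h1 h2].
have -> : b' / (b' - x') - b / (b - x)
    = (x' * b - x * b') / ((b - x) * (b' - x')).
  by field; rewrite h1 h2.
by rewrite divr_gt0 // subr_gt0.
Qed.

(** If no point of s lies in [b, r b], all terms move in the same direction.
    Otherwise the terms of the right-hand sum are shifted by one index before
    comparing: [r s_i < s_{i+1}] gives [s_i / b < s_{i+1} / (r b)]. *)
Lemma euler_sum_dilation_neq (R : realFieldType) (r b : R) (s : seq R) :
  1 < r -> 0 < b -> {in s, forall x, 0 < x} ->
  sorted (fun x y => r * x < y) s -> b \notin s -> r * b \notin s ->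
  s != [::] ->
  \sum_(x <- s) b / (b - x) != \sum_(x <- s) r * b / (r * b - x).
Proof.
move=> r_gt1 b_gt0 s_gt0 s_sorted bs rbs s_neq0.
have [/hasP[w ws /andP[bw wrb]]|/hasPn no_mid] :=
  boolP (has (fun x => (b < x) && (x < r * b)) s); last first.
  rewrite gt_eqF // big_seq [ltRHS]big_seq.
  have lt_term x : x \in s -> r * b / (r * b - x) < b / (b - x).
    move=> xs; have x_gt0 := s_gt0 x xs.
    apply: euler_term_lt; last by rewrite ltr_pM2l // ltr_pMl.
    have := no_mid x xs.
    have xb : x != b by apply: contraNneq bs => <-.
    have xrb : x != r * b by apply: contraNneq rbs => <-.
    rewrite negb_and -!leNgt !le_eqVlt (negPf xb).
    rewrite [r * b == x]eq_sym (negPf xrb).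
    have brb : b < r * b by rewrite ltr_pMl.
    case/orP => h; first by apply: mulr_gt0; lra.
    by rewrite -mulrNN; apply: mulr_gt0; lra.
  apply: ltr_sum => //.
  case: s s_neq0 {lt_term no_mid rbs bs s_sorted s_gt0} => // x s _.
  by rewrite /= mem_head.
rewrite lt_eqF //; case: s s_neq0 s_gt0 s_sorted bs rbs ws => // x0 s _ s_gt0.
set S := x0 :: s => s_sorted bs rbs ws.
pose a := nth 0 S.
have step i : (i < size s)%N -> r * a i < a i.+1.
  by move=> h; exact: (sortedP 0 s_sorted).
have a_gt0 i : (i <= size s)%N -> 0 < a i by move=> h; apply/s_gt0/mem_nth.
have a_neq i : (i <= size s)%N -> a i != b.
  by move=> h; apply: contraNneq bs => <-; apply: mem_nth.
have S_le : sorted <=%R S.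
  apply/(sortedP 0) => i h; have := step i h; have := a_gt0 i (ltnW h).
  rewrite -/(a i) -/(a i.+1); nra.
have a_le i j : (j <= size s)%N -> (i <= j)%N -> a i <= a j.
  move=> js ij; apply: (le_sorted_leq_nth 0 S_le) => //; rewrite inE /=; lia.
have [k ks aw] : exists2 k, (k <= size s)%N & a k = w.
  exists (index w S); last exact: nth_index.
  by rewrite -ltnS -[(size s).+1]/(size S) index_mem.
have sumE (f : R -> R) : \sum_(x <- S) f x = \sum_(i < (size s).+1) f (a i).
  by rewrite (big_nth 0) big_mkord.
(* The unmatched terms are the last one on the left, negative because the
   largest point exceeds b, and the first one on the right, positive because
   the smallest point is below r b. *)
rewrite !sumE big_ord_recr [ltRHS]big_ord_recl /= addrC; apply: ltr_leD.
  have ak0 := a_le 0%N k ks isT; have akn := a_le k (size s) (leqnn _) ks.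
  apply: (@lt_trans _ _ 0).
    by rewrite pmulr_rlt0 // invr_lt0 subr_lt0; lra.
  by rewrite divr_gt0 ?subr_gt0 ?mulr_gt0 //; lra.
apply: ler_sum => i _; have i_lt := ltn_ord i.
have -> : bump 0 i = i.+1 by [].
have si := step i i_lt; have aib := a_neq i (ltnW i_lt).
apply/ltW/euler_term_lt; last by rewrite mulrA [_ * r]mulrC ltr_pM2r.
case: (ltgtP (a i) b) aib => // h _.
  (* Without a point between b and r b, a_i and a_{i+1} could lie on
     different sides of the pole; here a_{i+1} <= a_k < r b. *)
  have : a i.+1 <= a k.
    apply: (a_le) => //; rewrite ltnNge; apply/negP => ki.
    by have := a_le k i (ltnW i_lt) ki; lra.
  by move=> ?; apply: mulr_gt0; lra.
have : r * b < r * a i by rewrite ltr_pM2l //; lra.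
by move=> ?; rewrite -mulrNN; apply: mulr_gt0; lra.
Qed.

(** * The list of roots sorted by modulus *)

Lemma count_roots_by_modulus (R : realType) (p : {poly R}) (x : R) :
  p != 0 -> count_mem x (roots_by_modulus p) = mup x p.
Proof.
move=> p0; rewrite /roots_by_modulus (permP (permEl (perm_sort _ _))).
rewrite count_flatten -map_comp.
have -> : [seq (count_mem x \o (fun y => nseq (mup y p) y)) y | y <- rootsR p]
    = [seq ((y == x) * mup x p)%N | y <- rootsR p].
  by apply: eq_map => y /=; rewrite count_nseq /=; case: eqP => // ->.
have := roots_on_rootsR p0 x; rewrite in_itv /= => xE.
have rts_uniq : uniq (rootsR p) by exact/lt_sorted_uniq/sorted_roots.
have := count_uniq_mem x rts_uniq; rewrite -xE -(sumn_count (pred1 x)).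
rewrite !sumnE !big_map -big_distrl /= => ->.
by case: (boolP (root p x)) => [_|/mupNroot ->]; rewrite ?mul1n ?muln0.
Qed.

Lemma poly_eq_prod_roots_by_modulus (R : realType) (p : {poly R}) :
  p != 0 ->
  (forall z, root (map_poly (real_complex R) p) z -> complex.Im z = 0) ->
  p = lead_coef p *: \prod_(x <- roots_by_modulus p) ('X - x%:P).
Proof.
move=> p0 p_real.
have [r rE] := closed_field_poly_normal (map_poly (real_complex R) p).
rewrite lead_coef_map in rE.
have c0 : lead_coef p != 0 by rewrite lead_coef_eq0.
have pE : p = lead_coef p *: \prod_(x <- map (@complex.Re R) r) ('X - x%:P).
  apply: (map_poly_inj (real_complex R)); rewrite [LHS]rE map_polyZ rmorph_prod.
  rewrite big_map; congr (_ *: _); apply: eq_big_seq => z zr.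
  rewrite rmorphB /= map_polyX map_polyC /=; congr ('X - _%:P).
  have : complex.Im z = 0.
    by apply: p_real; rewrite rE rootZ ?fmorph_eq0 // root_prod_XsubC.
  by case: z {zr} => a b /= ->.
rewrite {1}pE; congr (_ *: _); apply: perm_big; apply/allP => x _ /=.
rewrite count_roots_by_modulus // pE.
by rewrite -mul_polyC mupMr ?rootC // mu_prod_XsubC.
Qed.

(** * Polynomials with all roots on an open half-line *)

(** The half-line is [e x > 0]; with e = 1 or e = -1 this treats the two signs
    at once. *)
Definition roots_on_ray (R : realType) (e : R) (p : {poly R}) : Prop :=
  forall z : R[i], root (map_poly (real_complex R) p) z ->
    complex.Im z = 0 /\ 0 < e * complex.Re z.

Lemma real_roots_same_signP (R : realType) (p : {poly R}) :
  real_roots_same_sign p <-> exists2 e, e ^+ 2 = 1 & roots_on_ray e p.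
Proof.
split=> [[h|h]|[e /eqP]].
- by exists 1; [rewrite expr1n | move=> z /h; rewrite mul1r].
- by exists (-1); [rewrite sqrrN expr1n | move=> z /h; rewrite mulN1r oppr_gt0].
- rewrite sqrf_eq1 => /orP[/eqP->|/eqP->] h; [left|right] => z /h.
    by rewrite mul1r.
  by rewrite mulN1r oppr_gt0.
Qed.

Lemma roots_on_ray_neq0 (R : realType) (e : R) (p : {poly R}) :
  roots_on_ray e p -> p != 0.
Proof.
move=> h; apply/eqP => p0; case: (h 0) => [|_].
  by rewrite p0 rmorph0 root0.
by rewrite mulr0 ltxx.
Qed.

Lemma mem_roots_by_modulus (R : realType) (p : {poly R}) (x : R) :
  p != 0 -> (x \in roots_by_modulus p) = root p x.
Proof.
move=> p0; rewrite -has_pred1 has_count count_roots_by_modulus //.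
by rewrite -XsubC_dvd // dvdp_XsubCl.
Qed.

Lemma roots_by_modulus_gt0 (R : realType) (e : R) (p : {poly R}) :
  roots_on_ray e p -> {in roots_by_modulus p, forall x, 0 < e * x}.
Proof.
move=> h x; rewrite mem_roots_by_modulus ?(roots_on_ray_neq0 h) // => px.
by have [] := h (real_complex R x) (rmorph_root _ px).
Qed.

Lemma roots_on_ray_prod (R : realType) (e : R) (p : {poly R}) :
  roots_on_ray e p ->
  p = lead_coef p *: \prod_(x <- roots_by_modulus p) ('X - x%:P).
Proof.
move=> h; apply: poly_eq_prod_roots_by_modulus.
  exact: roots_on_ray_neq0 h.
by move=> z /h[].
Qed.

Lemma roots_on_ray_diff_op (R : realType) (lambda e : R) (p : {poly R}) :
  0 < lambda -> roots_on_ray e p -> e != 0 ->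
  roots_on_ray e (diff_op lambda p).
Proof.
move=> lambda_gt0 h e0 z.
have [/h //|] := boolP (root (map_poly (real_complex R) p) z).
have c0 : real_complex R (lead_coef p) != 0.
  by rewrite fmorph_eq0 lead_coef_eq0 (roots_on_ray_neq0 h).
have pE : map_poly (real_complex R) p = real_complex R (lead_coef p) *:
    \prod_(x <- map (real_complex R) (roots_by_modulus p)) ('X - x%:P).
  rewrite {1}(roots_on_ray_prod h) map_polyZ rmorph_prod big_map.
  congr (_ *: _); apply: eq_bigr => x _.
  by rewrite rmorphB /= map_polyX map_polyC.
rewrite pE rootZ // root_prod_XsubC => zs.
rewrite /diff_op rmorphD rmorphM /= map_polyZ map_polyX -deriv_map pE.
move/(root_euler_op_sum c0 zs); rewrite big_map.
exact/euler_sum_root_real/roots_by_modulus_gt0.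
Qed.

(** At a double root y of T(p), the equations T(p)(y) = T(p)'(y) = 0 give
    [y p' = - lambda p] and [y^2 p'' = lambda (lambda + 1) p] at y; then
    Laguerre's inequality reads [lambda (lambda + 1) p^2 <= lambda^2 p^2], which
    fails for [lambda > 0] and [p(y) <> 0]. *)
Lemma deriv_diff_op_neq0 (R : realType) (lambda e y : R) (p : {poly R}) :
  0 < lambda -> roots_on_ray e p -> ~~ root p y -> y != 0 ->
  root (diff_op lambda p) y -> (diff_op lambda p)^`().[y] != 0.
Proof.
move=> lambda_gt0 h py y0 Ty; apply/eqP => dTy.
have c0 : lead_coef p != 0 by rewrite lead_coef_eq0 (roots_on_ray_neq0 h).
have pE := roots_on_ray_prod h.
have := laguerre_prod_XsubC (roots_by_modulus p) y.
move: c0 Ty py dTy; rewrite {2 3 4}pE; move: (lead_coef p) => c c0.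
move: (\prod_(x <- _) _) => q; rewrite /diff_op /root => /eqP.
rewrite !(derivD, derivM, derivX, derivZ) mul1r.
rewrite !(hornerD, hornerM, hornerX, hornerZ) mulf_eq0 (negPf c0) /=.
move: q.[y] q^`().[y] q^`()^`().[y] => A B C h0 A0 h1 le_BB.
have yB : y * B = - lambda * A.
  apply: (mulfI c0); apply/eqP; rewrite -subr_eq0 -[X in _ == X]h0; apply/eqP.
  by ring.
have yC : y * C = - (lambda + 1) * B.
  apply: (mulfI c0); apply/eqP; rewrite -subr_eq0 -[X in _ == X]h1; apply/eqP.
  by ring.
have : y ^+ 2 * (A * C) <= y ^+ 2 * B ^+ 2 by rewrite ler_wpM2l ?sqr_ge0.
have -> : y ^+ 2 * B ^+ 2 = lambda ^+ 2 * A ^+ 2.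
  by rewrite -exprMn yB; ring.
have -> : y ^+ 2 * (A * C) = lambda * (lambda + 1) * A ^+ 2.
  transitivity (A * y * (y * C)); first by ring.
  rewrite yC; transitivity (- (lambda + 1) * A * (y * B)); first by ring.
  by rewrite yB; ring.
have : 0 < lambda * A ^+ 2 by rewrite mulr_gt0 // exprn_even_gt0.
by move=> ??; lra.
Qed.

(** A nonzero common root y of p and T(p) satisfies [y p'(y) = 0], so it is a
    multiple root of p. *)
Lemma uniq_roots_diff_op_disjoint (R : realType) (lambda e y : R)
    (p : {poly R}) :
  roots_on_ray e p -> uniq (roots_by_modulus p) -> y != 0 ->
  root (diff_op lambda p) y -> ~~ root p y.
Proof.
move=> h; rewrite -separable_prod_XsubC => s_sep y0 Ty; apply/negP => py.
have c0 : lead_coef p != 0 by rewrite lead_coef_eq0 (roots_on_ray_neq0 h).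
have qy : root (\prod_(x <- roots_by_modulus p) ('X - x%:P)) y.
  by rewrite -(rootZ _ _ c0) -(roots_on_ray_prod h).
move: s_sep; rewrite separable_poly.unlock => /coprimep_root/(_ qy).
apply/negP; rewrite negbK.
move: Ty; rewrite /root hornerD hornerM hornerX hornerZ (eqP py) mulr0 add0r.
rewrite mulf_eq0 (negPf y0) {1}(roots_on_ray_prod h) derivZ hornerZ.
by rewrite mulf_eq0 (negPf c0).
Qed.

Lemma uniq_roots_by_modulus (R : realType) (p : {poly R}) :
  p != 0 -> (forall x, root p x -> p^`().[x] != 0) ->
  uniq (roots_by_modulus p).
Proof.
move=> p0 simple; apply: count_mem_uniq => x.
rewrite count_roots_by_modulus // mem_roots_by_modulus //.
have [px|/mupNroot-> //] := boolP (root p x).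
apply/eqP; rewrite eqn_leq mup_leq // -XsubC_dvd // dvdp_XsubCl px andbT.
apply/negP => /dvdpP[r pE]; have := simple x px.
rewrite pE expr2 !derivM derivXsubC !(hornerXsubC, hornerD, hornerM) subrr.
by rewrite !(mul0r, mulr0, addr0) eqxx.
Qed.

Lemma lmesh_lt_sorted (R : realType) (p : {poly R}) (r : R) :
  {in roots_by_modulus p, forall x, x != 0} -> (r%:E < lmesh p)%E ->
  sorted (fun x y => r * `|x| < `|y|) (roots_by_modulus p).
Proof.
move=> s_neq0 /bigmin_gtP[_ r_lt]; apply/(sortedP 0) => i i_lt.
have i_lt' : (i < (size (roots_by_modulus p)).-1)%N by rewrite ltn_predRL.
have := r_lt (Ordinal i_lt') isT; rewrite /= lte_fin ltr_pdivlMr //.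
by rewrite normr_gt0 s_neq0 // mem_nth // ltnW.
Qed.

Lemma norm_on_ray (R : realDomainType) (e x : R) :
  e ^+ 2 = 1 -> 0 < e * x -> `|x| = e * x.
Proof.
move=> /eqP; rewrite sqrf_eq1 => /orP[]/eqP->.
  by rewrite mul1r => ?; rewrite gtr0_norm.
by rewrite mulN1r oppr_gt0 => ?; rewrite ltr0_norm.
Qed.

(** On a half-line [y / (y - x) = |y| / (|y| - |x|)], so both y and y' give
    solutions of the same equation on moduli, which a dilation by r cannot
    relate. *)
Lemma norm_roots_diff_op_neq (R : realType) (lambda e r y y' : R)
    (p : {poly R}) :
  0 < lambda -> e ^+ 2 = 1 -> roots_on_ray e p -> 1 < r ->
  sorted (fun x y => r * `|x| < `|y|) (roots_by_modulus p) ->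
  ~~ root p y -> ~~ root p y' ->
  root (diff_op lambda p) y -> root (diff_op lambda p) y' ->
  `|y'| != r * `|y|.
Proof.
move=> lambda_gt0 e2 h r_gt1 s_sorted py py' Ty Ty'; apply/eqP => yy'.
have e0 : e != 0 by rewrite -sqrf_eq0 e2 oner_eq0.
have hT := roots_on_ray_diff_op lambda_gt0 h e0.
have e_norm x := @norm_on_ray R e x e2.
have c0 : lead_coef p != 0 by rewrite lead_coef_eq0 (roots_on_ray_neq0 h).
have sumE z : root (diff_op lambda p) z -> ~~ root p z ->
    \sum_(x <- map Num.norm (roots_by_modulus p)) `|z| / (`|z| - x) = - lambda.
  move=> Tz; rewrite -(mem_roots_by_modulus _ (roots_on_ray_neq0 h)) => zs.
  have z_gt0 : 0 < e * z by have [] := hT _ (rmorph_root (real_complex R) Tz).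
  move: Tz; rewrite {1}(roots_on_ray_prod h).
  rewrite big_map => /(root_euler_op_sum c0 zs) <-.
  rewrite big_seq [RHS]big_seq; apply: eq_bigr => x xs.
  rewrite (e_norm z) // (e_norm x) ?(roots_by_modulus_gt0 h) //.
  by rewrite -mulrBr invfM mulrACA divff // mul1r.
have s_neq0 : map Num.norm (roots_by_modulus p) != [::].
  apply/eqP => s0; have := sumE y Ty py; rewrite s0 big_nil; lra.
have notin z : root (diff_op lambda p) z -> ~~ root p z ->
    `|z| \notin map Num.norm (roots_by_modulus p).
  move=> Tz pz; apply/mapP => -[x xs].
  have z_gt0 : 0 < e * z by have [] := hT _ (rmorph_root (real_complex R) Tz).
  rewrite (e_norm z) // (e_norm x) ?(roots_by_modulus_gt0 h) //.
  move/(mulfI e0) => zx; move: pz.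
  by rewrite zx -(mem_roots_by_modulus _ (roots_on_ray_neq0 h)) xs.
have y_gt0 : 0 < `|y|.
  rewrite normr_gt0; apply/eqP => y0.
  have [_ /=] := hT _ (rmorph_root (real_complex R) Ty).
  by rewrite y0 mulr0 ltxx.
have := euler_sum_dilation_neq r_gt1 y_gt0.
move/(_ (map Num.norm (roots_by_modulus p))).
rewrite -yy' !sumE // eqxx sorted_map => absurd.
suff : false by []; apply: absurd => //; try exact: notin.
by move=> _ /mapP[x xs ->]; rewrite e_norm (roots_by_modulus_gt0 h).
Qed.

Unset Implicit Arguments.

Theorem proposition5 (R : realType) (lambda : R) (lambda_gt0 : 0 < lambda)
    (p : {poly R}) (p_neq0 : p != 0) (p_roots : real_roots_same_sign p) :
  real_roots_same_sign (diff_op lambda p) /\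
  (lmesh p <= lmesh (diff_op lambda p))%E.
Proof.
have [e e2 h] := (real_roots_same_signP p).1 p_roots.
have e0 : e != 0 by rewrite -sqrf_eq0 e2 oner_eq0.
have hT := roots_on_ray_diff_op lambda_gt0 h e0.
split; first by apply: (real_roots_same_signP _).2; exists e.
have ray_neq0 q : roots_on_ray e q -> {in roots_by_modulus q, forall x, x != 0}.
  move=> hq x /(roots_by_modulus_gt0 hq); apply: contraTneq => ->.
  by rewrite mulr0 ltxx.
have T0 := roots_on_ray_neq0 hT.
apply/bigmin_geP; split=> [|j _]; first exact: leey.
set t := roots_by_modulus _ in j *.
have j_lt : (j.+1 < size t)%N by rewrite -ltn_predRL ltn_ord.
have memt i : (i < size t)%N -> root (diff_op lambda p) t`_i.
  by move=> it; rewrite -mem_roots_by_modulus // mem_nth.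
rewrite leNgt; apply/negP => r_lt.
have y0 : t`_j != 0 by apply: (ray_neq0 _ hT); rewrite mem_nth // ltnW.
have r_ge1 : 1 <= `|t`_j.+1| / `|t`_j|.
  rewrite ler_pdivlMr ?normr_gt0 // mul1r.
  have t_sorted : sorted (fun x y : R => `|x| <= `|y|) t.
    by apply: sort_sorted => x y; exact: le_total.
  exact: (sortedP 0 t_sorted).
(* A ratio r >= 1 below the mesh of p separates the moduli of its roots. *)
have s_sorted := lmesh_lt_sorted (ray_neq0 _ h) r_lt.
have s_uniq : uniq (roots_by_modulus p).
  apply: (@map_uniq _ _ Num.norm); apply: lt_sorted_uniq; rewrite sorted_map.
  by apply: sub_sorted s_sorted => x y /= ?; have := normr_ge0 x; nra.
have pT y : root (diff_op lambda p) y -> ~~ root p y.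
  move=> Ty; apply: (uniq_roots_diff_op_disjoint h s_uniq _ Ty).
  by apply: (ray_neq0 _ hT); rewrite mem_roots_by_modulus.
have t_uniq : uniq t.
  apply: uniq_roots_by_modulus => // y Ty.
  apply: (deriv_diff_op_neq0 lambda_gt0 h) => //; first exact: pT.
  by apply: (ray_neq0 _ hT); rewrite mem_roots_by_modulus.
have r_neq1 : `|t`_j.+1| / `|t`_j| != 1.
  apply/eqP => /divr1_eq.
  rewrite !(norm_on_ray e2) ?(roots_by_modulus_gt0 hT) //;
    rewrite ?mem_nth ?(ltnW j_lt) //.
  by move=> /(mulfI e0)/eqP; rewrite nth_uniq ?(ltnW j_lt) // gtn_eqF.
have r_gt1 : 1 < `|t`_j.+1| / `|t`_j| by rewrite lt_neqAle eq_sym r_neq1.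
have Tj := memt j (ltnW j_lt); have Tj1 := memt j.+1 j_lt.
have := norm_roots_diff_op_neq lambda_gt0 e2 h r_gt1 s_sorted.
move=> /(_ _ _ (pT _ Tj) (pT _ Tj1) Tj Tj1).
by rewrite divfK ?normr_eq0 // eqxx.
Qed.
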